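(* Let $\mathcal V$ be a variety that has a Taylor term. Then each of the following properties holds for $\mathcal V$ if and only if $\mathcal V$ has a weak difference term: \begin{enumerate} \item[(1)] In any algebra of $\mathcal V$, the congruence generated by an abelian tolerance is abelian. \item[(2)] For every $\mathbf A\in\mathcal V$ and congruences $\alpha,\beta$ of $\mathbf A$, the interval $\alpha/(\alpha\wedge\beta)$ is abelian if and only if the interval $(\alpha\vee\beta)/\beta$ is abelian. \item[(3)] There is no $\mathbf A\in\mathcal V$ with congruences $\beta,\delta,\theta,\alpha$ forming a pentagon sublattice of $\mathrm{Con}(\mathbf A)$ as follows: the five congruences $\beta\wedge\delta,\beta,\delta,\theta,\alpha$ are distinct, $\delta<\theta$, $\beta\wedge\theta=\beta\wedge\delta$, $\beta\vee\delta=\beta\vee\theta=\alpha$, and such that $\mathrm{C}(\beta,\beta;\beta\wedge\delta)$ holds. \end{enumerate}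
   Context: A tolerance on an algebra $\mathbf A$ is a reflexive, symmetric, compatible binary relation on $A$. For tolerances $S,T$ and a congruence $\delta$ of $\mathbf A$, the centralizer relation $\mathrm{C}(S,T;\delta)$ holds if for every term $t(x,y_1,\dots,y_n)$ of $\mathbf A$, every $(a,b)\in S$ and all $(c_i,d_i)\in T$, $t(a,\bar c)\mathrel{\delta} t(a,\bar d)$ implies $t(b,\bar c)\mathrel{\delta} t(b,\bar d)$. A tolerance $T$ is abelian if $\mathrm{C}(T,T;0)$ holds ($0$ = equality relation). For congruences $\gamma\le\eta$, the interval (congruence quotient) $\eta/\gamma$ is abelian if $\mathrm{C}(\eta,\eta;\gamma)$ holds. A Taylor term for $\mathcal V$ is a term $T(x_1,\dots,x_n)$ such that $\mathcal V\models T(x,\dots,x)\approx x$ and for each $i$, $\mathcal V$ satisfies some identity $T(\bar w)\approx T(\bar z)$ with $w_i\neq z_i$ ($\bar w,\bar z$ tuples of variables). A weak difference term for $\mathcal V$ is a term $w(x,y,z)$ such that for every $\mathbf B\in\mathcal V$, $w^{\mathbf B}(a,a,b)=b=w^{\mathbf B}(b,a,a)$ whenever $(a,b)$ lies in an abelian congruence of $\mathbf B$. *)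

(* Defs.v *)
From mathcomp Require Import all_boot.
Set Implicit Arguments. Unset Strict Implicit. Unset Printing Implicit Defensive.

Record signature := Signature { op : Type ; arity : op -> nat }.

Record algebra (sig : signature) := Algebra {
  carrier :> Type ;
  interp : forall f : op sig, ('I_(arity f) -> carrier) -> carrier }.

Inductive term (sig : signature) (X : Type) : Type :=
| Var : X -> term sig X
| App : forall f : op sig, ('I_(arity f) -> term sig X) -> term sig X.

Fixpoint eval (sig : signature) (X : Type) (A : algebra sig) (env : X -> A)
  (t : term sig X) : A :=
  match t with
  | Var x => env x
  | App f args => @interp sig A f (fun i => eval env (args i))
  end.

Section UA.
Variable sig : signature.

(* A variety, presented by a set E of identities in countably many variables:
   its members are the algebras satisfying every identity of E. *)
Definition in_variety (E : term sig nat -> term sig nat -> Prop) (A : algebra sig) :=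
  forall s t, E s t -> forall env : nat -> A, eval env s = eval env t.

Variable A : algebra sig.

Definition rel := A -> A -> Prop.

Definition compatible (R : rel) :=
  forall (f : op sig) (x y : 'I_(arity f) -> A),
    (forall i, R (x i) (y i)) -> R (@interp sig A f x) (@interp sig A f y).

Definition tolerance (R : rel) :=
  (forall x, R x x) /\ (forall x y, R x y -> R y x) /\ compatible R.

Definition congruence (R : rel) :=
  (forall x, R x x) /\ (forall x y, R x y -> R y x) /\
  (forall x y z, R x y -> R y z -> R x z) /\ compatible R.

Definition subrel (R S : rel) := forall x y, R x y -> S x y.
Definition releq (R S : rel) := forall x y, R x y <-> S x y.

Definition Cg (R : rel) : rel :=
  fun x y => forall th, congruence th -> subrel R th -> th x y.

Definition cmeet (R S : rel) : rel := fun x y => R x y /\ S x y.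
Definition cjoin (R S : rel) : rel := Cg (fun x y => R x y \/ S x y).

Definition zero_rel : rel := fun x y => x = y.

(* The centralizer relation C(S,T;delta): for every term t(x, y_1..y_n)
   (x is the variable None, y_i is Some i). *)
Definition centralizes (S T delta : rel) :=
  forall (n : nat) (t : term sig (option 'I_n)) (a b : A) (c d : 'I_n -> A),
    S a b -> (forall i, T (c i) (d i)) ->
    delta (eval (fun v => match v with None => a | Some i => c i end) t)
          (eval (fun v => match v with None => a | Some i => d i end) t) ->
    delta (eval (fun v => match v with None => b | Some i => c i end) t)
          (eval (fun v => match v with None => b | Some i => d i end) t).

Definition abelian (T : rel) := centralizes T T zero_rel.
End UA.

Section Variety.
Variable sig : signature.
Variable E : term sig nat -> term sig nat -> Prop.

Definition env3 (B : Type) (a b c : B) : 'I_3 -> B := fun i => nth a [:: a; b; c] i.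

Definition taylor_term (n : nat) (T : term sig 'I_n) :=
  (forall A : algebra sig, in_variety E A -> forall a : A, eval (fun _ => a) T = a) /\
  (forall i : 'I_n, exists w z : 'I_n -> nat, w i <> z i /\
     forall A : algebra sig, in_variety E A -> forall env : nat -> A,
       eval (fun j => env (w j)) T = eval (fun j => env (z j)) T).

Definition has_taylor_term := exists n (T : term sig 'I_n), taylor_term T.

Definition weak_difference_term (w : term sig 'I_3) :=
  forall B : algebra sig, in_variety E B ->
  forall th : rel B, congruence th -> abelian th ->
  forall a b : B, th a b ->
    eval (env3 a a b) w = b /\ eval (env3 b a a) w = b.

Definition has_weak_difference_term := exists w, weak_difference_term w.

Definition property1 :=
  forall A : algebra sig, in_variety E A ->
  forall T : rel A, tolerance T -> abelian T -> abelian (Cg T).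

Definition property2 :=
  forall A : algebra sig, in_variety E A ->
  forall alpha beta : rel A, congruence alpha -> congruence beta ->
    (centralizes alpha alpha (cmeet alpha beta) <->
     centralizes (cjoin alpha beta) (cjoin alpha beta) beta).

Definition property3 :=
  ~ exists (A : algebra sig), in_variety E A /\
    exists beta delta theta alpha : rel A,
      (congruence beta /\ congruence delta /\ congruence theta /\ congruence alpha) /\
      (let bd := cmeet beta delta in
       (~ releq bd beta /\ ~ releq bd delta /\ ~ releq bd theta /\ ~ releq bd alpha /\
        ~ releq beta delta /\ ~ releq beta theta /\ ~ releq beta alpha /\
        ~ releq delta theta /\ ~ releq delta alpha /\ ~ releq theta alpha) /\
       subrel delta theta /\
       releq (cmeet beta theta) bd /\
       releq (cjoin beta delta) alpha /\ releq (cjoin beta theta) alpha /\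
       centralizes beta beta bd).
End Variety.

(* Main.v *)
Require Import Defs.
From mathcomp Require Import all_boot.
From Stdlib Require Import Classical ClassicalEpsilon FunctionalExtensionality.
From Stdlib Require Import PropExtensionality ProofIrrelevance.
Set Implicit Arguments. Unset Strict Implicit. Unset Printing Implicit Defensive.

(** From a weak difference term w to (1).  Let T be an abelian tolerance and th the
    congruence it generates.  Call two th-related elements mergeable if, after being
    plugged into any polynomial, they become equal by repeatedly applying the Taylor term
    with suitable th-related side arguments.  Mergeability is a congruence modulo which th
    is abelian, and by the Taylor identities it meets T trivially.  As w(a,a,b) and b are
    both mergeable and T-related when a T b, w is a Maltsev operation on T-related pairs.
    This makes the composite of T with itself abelian again, and th is the union of the
    iterated composites.  Property (2) is (1) applied to the image of alpha in A/beta, and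
    (3) follows because w makes dl o be o dl transitive in the pentagon.

    Conversely, let B be generated by x and y, freely subject to (x,y) lying in an abelian
    congruence th, and view th as a subalgebra A of B x B.  The first projection kernel be
    is abelian.  Inside the second one there is a congruence dl identifying (x,x) with
    (y,x), such that (x,y) dl (y,y) forces a weak difference term to exist.  If it fails,
    be and dl span a forbidden pentagon; and if the interval from dl to the join of be and
    dl is abelian, as (2) requires, the Taylor identities give (x,y) dl (y,y). *)

(** * Choice, and tuples changed in one coordinate *)

Lemma fun_choice (I : Type) (X : I -> Type) (P : forall i, X i -> Prop) :
  (forall i, exists x, P i x) -> exists f : forall i, X i, forall i, P i (f i).
Proof.
move=> H; exists (fun i => sval (constructive_indefinite_description _ (H i))).
by move=> i; case: constructive_indefinite_description.
Qed.

Definition upd (I : eqType) (X : Type) (x : I -> X) (i : I) (a : X) : I -> X :=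
  fun j => if j == i then a else x j.

Lemma upd_same (I : eqType) X (x : I -> X) i a : x i = a -> upd x i a = x.
Proof.
by move=> <-; apply: functional_extensionality => j; rewrite /upd; case: eqP => // ->.
Qed.

Lemma comp_upd (I : eqType) X Y (g : X -> Y) (x : I -> X) i a :
  (fun j => g (upd x i a j)) = upd (fun j => g (x j)) i (g a).
Proof. by apply: functional_extensionality => j; rewrite /upd; case: ifP. Qed.

(** Coordinates of [x] are replaced along a duplicate-free list, so each is still untouched when its
    turn comes. *)
Lemma stepwise_ind (I : finType) X (x y : I -> X) (P : (I -> X) -> Prop) :
  P x ->
  (forall z i, (forall j, z j = x j \/ z j = y j) -> z i = x i -> P z ->
     P (upd z i (y i))) ->
  P y.
Proof.
move=> Px step; pose v (s : seq I) j := if j \in s then y j else x j.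
have Pv s : uniq s -> P (v s).
  elim: s => [|i s IH] /=.
    by rewrite (_ : v [::] = x) //; apply: functional_extensionality.
  case/andP=> nis us.
  rewrite (_ : v (i :: s) = upd (v s) i (y i)).
    apply: step; last exact: IH.
      by move=> j; rewrite /v; case: ifP; [right|left].
    by rewrite /v (negbTE nis).
  apply: functional_extensionality => j; rewrite /v /upd inE.
  by case: eqP => [->|].
have := Pv (enum I) (enum_uniq _).
rewrite (_ : v _ = y) //; apply: functional_extensionality => j.
by rewrite /v mem_enum.
Qed.

(** * Terms, compatible relations and generated congruences *)

Section Algebras.
Variable sig : signature.
Implicit Types A B : algebra sig.

Fixpoint tsubst (X Y : Type) (s : X -> term sig Y) (t : term sig X) : term sig Y :=
  match t with
  | Var x => s x
  | App f args => @App sig Y f (fun i => tsubst s (args i))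
  end.

Lemma eval_tsubst X Y A (env : Y -> A) (s : X -> term sig Y) t :
  eval env (tsubst s t) = eval (fun x => eval env (s x)) t.
Proof.
elim: t => //= f args IH; congr interp; exact: functional_extensionality.
Qed.

Lemma eval_ext X A (e e' : X -> A) t : (forall x, e x = e' x) -> eval e t = eval e' t.
Proof. by move=> H; rewrite (functional_extensionality _ _ H). Qed.

Lemma eval_compatible X A (R : A -> A -> Prop) (e e' : X -> A) t :
  compatible R -> (forall x, R (e x) (e' x)) -> R (eval e t) (eval e' t).
Proof. by move=> cR H; elim: t => //= f args IH; apply: cR. Qed.

Lemma env3_map X Y (g : X -> Y) a b c i : g (env3 a b c i) = env3 (g a) (g b) (g c) i.
Proof. by case: i => [[|[|[|]]]]. Qed.

Lemma compatible_translations A (R : A -> A -> Prop) :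
  (forall a, R a a) -> (forall a b c, R a b -> R b c -> R a c) ->
  (forall f x i a b, R a b ->
     R (@interp sig A f (upd x i a)) (@interp sig A f (upd x i b))) ->
  compatible R.
Proof.
move=> rR tR H f x y xy.
apply: (stepwise_ind (x := x) (y := y)
  (P := fun z => R (@interp sig A f x) (@interp sig A f z))) => //.
move=> z i _ zi xz; apply: tR xz _.
by rewrite -{1}(upd_same zi); apply: H.
Qed.

Lemma Cg_congruence A (R : A -> A -> Prop) : congruence (Cg R).
Proof.
split; first by move=> x th [].
split; first by move=> x y H th cth s; case: (cth) => _ [+ _]; apply; exact: H.
split.
  move=> x y z H1 H2 th cth s; case: (cth) => _ [_ [+ _]].
  by apply; [exact: H1|exact: H2].
move=> f x y H th cth s; case: (cth) => _ [_ [_ +]].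
by apply=> i; apply: H.
Qed.

Lemma sub_Cg A (R : A -> A -> Prop) : Defs.subrel R (Cg R).
Proof. by move=> x y Rxy th _; apply. Qed.

Lemma congruence_eq A : congruence (@zero_rel sig A).
Proof.
split=> //; split=> [x y ->|] //; split=> [x y z -> //|f x y H].
by congr interp; apply: functional_extensionality.
Qed.

Lemma congruence_cmeet A (R S : A -> A -> Prop) :
  congruence R -> congruence S -> congruence (cmeet R S).
Proof.
move=> [rR [sR [tR cR]]] [rS [sS [tS cS]]].
split; first by split.
split; first by move=> x y [] *; split; auto.
split; first by move=> x y z [? ?] [? ?]; split; eauto.
by move=> f x y H; split; [apply: cR|apply: cS] => i; case: (H i).
Qed.

(** * Twin polynomials and the term condition *)

(* Pairs of unary polynomials t(x,c), t(x,d) of the same term with T-related parameters. *)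
Inductive twin A (T : A -> A -> Prop) : (A -> A) -> (A -> A) -> Prop :=
| twin_id : twin T (fun a => a) (fun a => a)
| twin_const c d : T c d -> twin T (fun _ => c) (fun _ => d)
| twin_interp f (g h : 'I_(arity f) -> A -> A) :
    (forall i, twin T (g i) (h i)) ->
    twin T (fun a => @interp sig A f (fun i => g i a))
           (fun a => @interp sig A f (fun i => h i a)).

Definition polynomial A (k : A -> A) := twin eq k k.

Lemma twin_mono A (S T : A -> A -> Prop) g h :
  (forall a b, S a b -> T a b) -> twin S g h -> twin T g h.
Proof. by move=> ST; elim=> *; constructor; auto. Qed.

Lemma twin_left A (S T : A -> A -> Prop) g h :
  (forall a, T a a) -> twin S g h -> twin T g g.
Proof. by move=> rT; elim=> *; constructor; auto. Qed.

Lemma twin_polynomial A (T : A -> A -> Prop) k :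
  (forall a, T a a) -> polynomial k -> twin T k k.
Proof. by move=> rT; apply: twin_mono => a _ <-. Qed.

Lemma twin_comp A (T : A -> A -> Prop) g h g' h' :
  twin T g h -> twin T g' h' -> twin T (fun a => g (g' a)) (fun a => h (h' a)).
Proof.
move=> + H; elim=> // [c d Tcd|f g1 h1 _ IH]; first exact: twin_const.
exact: (twin_interp (g := fun i a => g1 i (g' a)) (h := fun i a => h1 i (h' a))).
Qed.

Lemma twin_eval X A (T : A -> A -> Prop) (G H : X -> A -> A) t :
  (forall x, twin T (G x) (H x)) ->
  twin T (fun a => eval (fun x => G x a) t) (fun a => eval (fun x => H x a) t).
Proof.
move=> tGH; elim: t => //= f args IH.
exact: (twin_interp (g := fun i a => eval (fun x => G x a) (args i))
                    (h := fun i a => eval (fun x => H x a) (args i))).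
Qed.

Lemma twin_upd A (T : A -> A -> Prop) (I : eqType) (x y : I -> A) i g h :
  (forall j, T (x j) (y j)) -> twin T g h ->
  forall j, twin T (fun a => upd x i (g a) j) (fun a => upd y i (h a) j).
Proof. by move=> Txy tgh j; rewrite /upd; case: (j == i) => //; apply: twin_const. Qed.

Lemma twin_interp_upd A (T : A -> A -> Prop) f (x y : 'I_(arity f) -> A) i g h :
  (forall j, T (x j) (y j)) -> twin T g h ->
  twin T (fun a => @interp sig A f (upd x i (g a))) (fun a => @interp sig A f (upd y i (h a))).
Proof.
move=> Txy tgh.
exact: (twin_interp (g := fun j a => upd x i (g a) j) (h := fun j a => upd y i (h a) j)
  (twin_upd i Txy tgh)).
Qed.

Lemma twin_eval_upd A (T : A -> A -> Prop) (I : eqType) t (x y : I -> A) i g h :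
  (forall j, T (x j) (y j)) -> twin T g h ->
  twin T (fun a => eval (upd x i (g a)) t) (fun a => eval (upd y i (h a)) t).
Proof.
move=> Txy tgh.
exact: (twin_eval (G := fun j a => upd x i (g a) j) (H := fun j a => upd y i (h a) j)
  t (twin_upd i Txy tgh)).
Qed.

Lemma twin_rel A (T : A -> A -> Prop) g h a b :
  compatible T -> twin T g h -> T a b -> T (g a) (h b).
Proof. by move=> cT tgh Tab; elim: tgh => // f g1 h1 _ IH; apply: cT. Qed.

Definition term_condition A (S T d : A -> A -> Prop) :=
  forall g h a b, twin T g h -> S a b -> d (g a) (h a) -> d (g b) (h b).

Definition pointed_env A n (a : A) (c : 'I_n -> A) : option 'I_n -> A :=
  fun v => match v with None => a | Some i => c i end.

Lemma twin_term A (T : A -> A -> Prop) g h : twin T g h ->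
  exists n (t : term sig (option 'I_n)) (c d : 'I_n -> A),
    (forall i, T (c i) (d i)) /\
    forall a, g a = eval (pointed_env a c) t /\ h a = eval (pointed_env a d) t.
Proof.
elim=> [|c d Tcd|f g1 h1 _ IH].
- pose c0 : 'I_0 -> A := fun i => match i with Ordinal m lt_m0 => False_rect A (notF lt_m0) end.
  by exists 0, (Var sig None), c0, c0; split=> // -[].
- by exists 1, (Var sig (Some ord0)), (fun _ => c), (fun _ => d).
have [n /fun_choice [t /fun_choice [c /fun_choice [d H]]]] := fun_choice IH.
(* Parameters of different arguments must stay apart, so the new term gets one variable for each
   pair of an argument and one of its parameters. *)
pose X : finType := {i : 'I_(arity f) & 'I_(n i)}.
pose emb i (v : option 'I_(n i)) : option 'I_#|X| :=
  omap (fun j => enum_rank (Tagged (fun i => 'I_(n i)) j : X)) v.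
exists #|X|, (@App sig _ f (fun i => tsubst (fun v => Var sig (emb i v)) (t i))).
exists (fun k => c (tag (enum_val k)) (tagged (enum_val k))).
exists (fun k => d (tag (enum_val k)) (tagged (enum_val k))).
split=> [k|a]; first by case: (H (tag (enum_val k))).
split=> /=; congr interp; apply: functional_extensionality => i;
  have [_ /(_ a)[Eg Eh]] := H i; rewrite ?Eg ?Eh eval_tsubst;
  by apply: eval_ext => -[j|] //=; rewrite enum_rankK.
Qed.

Lemma centralizesP A (S T d : A -> A -> Prop) :
  centralizes S T d <-> term_condition S T d.
Proof.
split=> [H g h a b tgh Sab | H n t a b c e Sab Tce].
  have [n [t [c [e [Tce E]]]]] := twin_term tgh.
  by have [[-> ->] [-> ->]] := (E a, E b); apply: H.
apply: (H (fun a => eval (pointed_env a c) t) (fun a => eval (pointed_env a e) t)) => //.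
apply: (twin_eval (G := fun v a => pointed_env a c v) (H := fun v a => pointed_env a e v)).
by case=> [i|]; [exact: twin_const|exact: twin_id].
Qed.

Lemma abelian_zero A : abelian (@zero_rel sig A).
Proof. by apply/centralizesP => g h a b _ ->. Qed.

(** The pairs that no [T]-twins tell apart modulo [d] form a congruence, since twins preceded by a
    translation are again twins. By symmetry of [S] it contains [S]. *)
Lemma term_condition_Cg A (S T d : A -> A -> Prop) :
  (forall a b, S a b -> S b a) -> (forall a, T a a) ->
  term_condition S T d -> term_condition (Cg S) T d.
Proof.
move=> sS rT H.
pose R a b := forall g h, twin T g h -> (d (g a) (h a) <-> d (g b) (h b)).
have cR : congruence R.
  have tR a b c : R a b -> R b c -> R a c.
    by move=> R1 R2 g h tgh; rewrite (R1 g h) // (R2 g h).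
  split=> //; split; first by move=> a b Rab g h tgh; rewrite (Rab g h).
  split=> //; apply: compatible_translations => // f x i a b Rab g h tgh.
  have tx : twin T (fun a => @interp sig A f (upd x i a)) (fun a => @interp sig A f (upd x i a)).
    by apply: twin_interp_upd => //; constructor.
  exact: Rab _ _ (twin_comp tgh tx).
move=> g h a b tgh Sab; suff Rab : R a b by rewrite (Rab g h).
by apply: Sab => // x y Sxy g' h' tgh'; split; apply: H => //; apply: sS.
Qed.

(* The matrix [a b; c d]: its rows are T-related and its columns S-related. *)
Inductive mat A (S T : A -> A -> Prop) : A -> A -> A -> A -> Prop :=
| mat_row a b : S a b -> mat S T a a b b
| mat_col c d : T c d -> mat S T c d c d
| mat_interp f (x y z w : 'I_(arity f) -> A) :
    (forall i, mat S T (x i) (y i) (z i) (w i)) ->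
    mat S T (@interp sig A f x) (@interp sig A f y)
            (@interp sig A f z) (@interp sig A f w).

Lemma mat_eval X A (S T : A -> A -> Prop) (x y z w : X -> A) t :
  (forall i, mat S T (x i) (y i) (z i) (w i)) ->
  mat S T (eval x t) (eval y t) (eval z t) (eval w t).
Proof. by move=> H; elim: t => //= f args IH; apply: mat_interp. Qed.

Lemma mat_twin A (S T : A -> A -> Prop) g h a b :
  twin S g h -> T a b -> mat S T (g a) (g b) (h a) (h b).
Proof.
move=> + Tab; elim=> [|c d Scd|f g1 h1 _ IH].
- exact: mat_col.
- exact: mat_row.
- exact: mat_interp.
Qed.

Lemma mat_rows A (S T : A -> A -> Prop) a b c d :
  (forall a, T a a) -> compatible T -> mat S T a b c d -> T a b /\ T c d.
Proof.
move=> rT cT; elim=> // f x y z w _ IH.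
by split; apply: cT => i; case: (IH i).
Qed.

(* The term condition moves a single S-variable; the other ones are moved one at a
   time, the remaining columns being absorbed into the T-related parameters. *)
Lemma term_condition_mat A (S T dl : A -> A -> Prop) a b c d :
  (forall a, T a a) -> compatible T -> term_condition S T dl ->
  mat S T a b c d -> dl a b -> dl c d.
Proof.
move=> rT cT H M.
suff: forall k l, twin T k l -> dl (k a) (l b) -> dl (k c) (l d).
  by apply; constructor.
elim: M => // [a' b' Sab k l tkl|f x y z w M IH k l tkl Hxy]; first exact: H.
pose P (v : 'I_(arity f) -> A * A) :=
  dl (k (@interp sig A f (fun i => (v i).1))) (l (@interp sig A f (fun i => (v i).2))).
apply: (stepwise_ind (x := fun i => (x i, y i)) (y := fun i => (z i, w i)) (P := P)) => //.
move=> v i vE vi; rewrite /P !comp_upd /=.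
rewrite -{1}(upd_same (x := fun j => (v j).1) (i := i) (a := x i)) ?vi //.
rewrite -{1}(upd_same (x := fun j => (v j).2) (i := i) (a := y i)) ?vi //.
apply: (IH i (fun u => k (@interp sig A f (upd (fun j => (v j).1) i u)))
            (fun u => l (@interp sig A f (upd (fun j => (v j).2) i u)))).
apply: (twin_comp tkl); apply: twin_interp_upd; last by constructor.
by move=> j; case: (mat_rows rT cT (M j)) => ? ?; case: (vE j) => ->.
Qed.

(** * Homomorphisms and quotients *)

Definition hom A B (phi : A -> B) :=
  forall f x, phi (@interp sig A f x) = @interp sig B f (fun i => phi (x i)).

Lemma hom_eval A B (phi : A -> B) X (e : X -> A) t :
  hom phi -> phi (eval e t) = eval (fun x => phi (e x)) t.
Proof.
move=> hp; elim: t => //= f args IH; rewrite hp; congr interp.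
exact: functional_extensionality.
Qed.

Definition image_rel A B (phi : A -> B) (R : A -> A -> Prop) : B -> B -> Prop :=
  fun p q => exists a b, [/\ R a b, phi a = p & phi b = q].

Lemma twin_lift A B (phi : A -> B) (R : A -> A -> Prop) g h :
  hom phi -> twin (image_rel phi R) g h ->
  exists g0 h0, twin R g0 h0 /\
    forall a, g (phi a) = phi (g0 a) /\ h (phi a) = phi (h0 a).
Proof.
move=> hp; elim=> [|c d [a [b [Rab <- <-]]]|f g1 h1 _ IH].
- by exists (fun a => a), (fun a => a); split=> //; constructor.
- by exists (fun _ => a), (fun _ => b); split=> //; constructor.
have [g0 /fun_choice [h0 H]] := fun_choice IH.
exists (fun a => @interp sig A f (fun i => g0 i a)).
exists (fun a => @interp sig A f (fun i => h0 i a)).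
split=> [|a]; first by apply: twin_interp => i; case: (H i).
rewrite !hp; split; congr interp; apply: functional_extensionality => i;
  by have [_ /(_ a)[Eg Eh]] := H i; rewrite ?Eg ?Eh.
Qed.

Lemma twin_push A B (phi : A -> B) (R : A -> A -> Prop) (S : B -> B -> Prop) g h :
  hom phi -> (forall a b, R a b -> S (phi a) (phi b)) -> twin R g h ->
  exists g1 h1, twin S g1 h1 /\
    forall a, phi (g a) = g1 (phi a) /\ phi (h a) = h1 (phi a).
Proof.
move=> hp RS; elim=> [|c d Rcd|f g0 h0 _ IH].
- by exists (fun a => a), (fun a => a); split=> //; constructor.
- by exists (fun _ => phi c), (fun _ => phi d); split=> //; constructor; apply: RS.
have [g1 /fun_choice [h1 H]] := fun_choice IH.
exists (fun a => @interp sig B f (fun i => g1 i a)).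
exists (fun a => @interp sig B f (fun i => h1 i a)).
split=> [|a]; first by apply: twin_interp => i; case: (H i).
rewrite !hp; split; congr interp; apply: functional_extensionality => i;
  by have [_ /(_ a)[Eg Eh]] := H i; rewrite ?Eg ?Eh.
Qed.

Lemma congruence_preimage A B (phi : A -> B) (R : B -> B -> Prop) :
  hom phi -> congruence R -> congruence (fun a b => R (phi a) (phi b)).
Proof.
move=> hp [rR [sR [tR cR]]]; split=> //; split; first by move=> a b; apply: sR.
split; first by move=> a b c; apply: tR.
by move=> f x y H; rewrite !hp; apply: cR.
Qed.

Lemma image_compatible A B (phi : A -> B) (R : A -> A -> Prop) :
  hom phi -> compatible R -> compatible (image_rel phi R).
Proof.
move=> hp cR f x y /fun_choice [a /fun_choice [b H]].
exists (@interp sig A f a), (@interp sig A f b).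
split; first by apply: cR => i; case: (H i).
  by rewrite hp; congr interp; apply: functional_extensionality => i; case: (H i).
by rewrite hp; congr interp; apply: functional_extensionality => i; case: (H i).
Qed.

(** The quotient lives on representatives picked by [epsilon]: related elements have equal classes
    by extensionality, hence the same representative. *)
Lemma quotient_exists A (R : A -> A -> Prop) : congruence R ->
  exists B (phi : A -> B), [/\ hom phi, forall b, exists a, phi a = b &
    forall a b, phi a = phi b <-> R a b].
Proof.
move=> [rR [sR [tR cR]]].
pose repr a := epsilon (inhabits a) (R a).
have reprP a : R a (repr a) by apply: epsilon_spec; exists a.
have reprE a b : R a b -> repr a = repr b.
  move=> Rab; have E : R a = R b.
    apply: functional_extensionality => c; apply: propositional_extensionality.
    by split; [apply: tR; apply: sR|apply: tR].
  by rewrite /repr E; congr epsilon; apply: proof_irrelevance.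
have repr_repr a : repr (repr a) = repr a by apply/esym/reprE.
pose C := {a : A | repr a = a}.
pose cls a : C := exist _ (repr a) (repr_repr a).
have clsE (p q : C) : sval p = sval q -> p = q.
  by case: p q => [a pa] [b pb] /= E; subst b; congr exist; apply: proof_irrelevance.
pose B := @Algebra sig C (fun f x => cls (@interp sig A f (fun i => sval (x i)))).
exists B, cls; split.
- move=> f x; apply: clsE => /=; apply: reprE; apply: cR => i; exact: reprP.
- by move=> p; exists (sval p); apply: clsE; case: p.
- move=> a b; split=> [/(f_equal sval) /= E|Rab]; last by apply: clsE; apply: reprE.
  by apply: tR (reprP a) _; rewrite E; apply: sR.
Qed.

Lemma in_variety_image E A B (phi : A -> B) :
  hom phi -> (forall b, exists a, phi a = b) -> in_variety E A -> in_variety E B.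
Proof.
move=> hp sp VA s t Est env; have [e He] := fun_choice (fun v => sp (env v)).
rewrite -!(functional_extensionality _ _ He : _ = env) -!hom_eval //.
by rewrite (VA _ _ Est).
Qed.

End Algebras.

(** * Consequences of a weak difference term *)

Section Variety.
Variables (sig : signature) (E : term sig nat -> term sig nat -> Prop).
Implicit Types A B : algebra sig.

(** The definition of [w] is applied in the quotient by [dl], where the image of [th] is abelian,
    and transitive because [dl] lies inside [th]. *)
Lemma weak_difference_term_mod w A (dl th : A -> A -> Prop) a b :
  weak_difference_term E w -> in_variety E A ->
  congruence dl -> congruence th -> Defs.subrel dl th ->
  term_condition th th dl -> th a b ->
  dl (eval (env3 a a b) w) b /\ dl (eval (env3 b a a) w) b.
Proof.
move=> Hw VA cdl [rth [sth [tth cth]]] sub tc thab.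
have [B [phi [hp surj phiE]]] := quotient_exists cdl.
have VB := in_variety_image hp surj VA.
have cim : congruence (image_rel phi th).
  split; first by move=> p; have [c <-] := surj p; exists c, c.
  split; first by move=> p q [c [d [H1 H2 H3]]]; exists d, c; split=> //; apply: sth.
  split; last exact: image_compatible.
  move=> _ _ _ [c [d [H1 <- <-]]] [c' [d' [H2 /phiE/sub H3 <-]]].
  exists c, d'; split=> //; exact: (tth _ _ _ H1 (tth _ _ _ (sth _ _ H3) H2)).
have ab : abelian (image_rel phi th).
  apply/centralizesP => g h _ _ /(twin_lift hp)[g0 [h0 [tgh H]]] [c [d [thcd <- <-]]].
  have [[-> ->] [-> ->]] := (H c, H d).
  by move/phiE=> dlc; apply/phiE; apply: tc dlc.
have [|H1 H2] := Hw B VB _ cim ab (phi a) (phi b); first by exists a, b.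
have phi3 c d e : phi (eval (env3 c d e) w) = eval (env3 (phi c) (phi d) (phi e)) w.
  by rewrite hom_eval //; apply: eval_ext => i; apply: env3_map.
by split; apply/phiE; rewrite phi3.
Qed.

Lemma weak_difference_term_idem w A (a : A) :
  weak_difference_term E w -> in_variety E A -> eval (env3 a a a) w = a.
Proof.
by move=> Hw VA; have [] := Hw A VA _ (congruence_eq A) (@abelian_zero _ A) a a erefl.
Qed.

Lemma property1_property2 : property1 E -> property2 E.
Proof.
move=> P1 A VA al be cal cbe; have [ral [sal [tal compal]]] := cal.
split=> /centralizesP tc; apply/centralizesP; last first.
  move=> g h a b tgh ab [_ Hbe]; split.
    exact: twin_rel compal tgh (ral b).
  have alJ : Defs.subrel al (cjoin al be) by move=> x y xy; apply: sub_Cg; left.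
  by apply: tc Hbe; [apply: twin_mono tgh|apply: alJ].
have [B [phi [hp surj phiE]]] := quotient_exists cbe.
have VB := in_variety_image hp surj VA.
(* The image of [al] may fail to be transitive, so only a tolerance is available; the congruence it
   generates receives the join. *)
pose T := image_rel phi al.
have tolT : tolerance T.
  split; first by move=> p; have [c <-] := surj p; exists c, c.
  split; last exact: image_compatible.
  by move=> p q [c [d [H1 H2 H3]]]; exists d, c; split=> //; apply: sal.
have abT : abelian T.
  apply/centralizesP => g h _ _ /(twin_lift hp)[g0 [h0 [tgh H]]] [c [d [alcd <- <-]]].
  have [[-> ->] [-> ->]] := (H c, H d).
  move/phiE=> bec; apply/phiE; have [] // := tc _ _ c d tgh alcd; split=> //.
  exact: twin_rel compal tgh (ral c).
have /centralizesP tcC := P1 B VB T tolT abT.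
have JC a b : cjoin al be a b -> Cg T (phi a) (phi b).
  move=> /(_ _ (congruence_preimage hp (Cg_congruence T))); apply=> x y [] xy.
    by apply: sub_Cg; exists x, y.
  by have /phiE -> := xy; case: (Cg_congruence T).
move=> g h a b /(twin_push hp JC)[g1 [h1 [tgh H]]] /JC ab /phiE.
have [[-> ->] [Eg Eh]] := (H a, H b) => Ea; apply/phiE; rewrite Eg Eh.
exact: tcC tgh ab Ea.
Qed.

Lemma property3_of_property2 w :
  weak_difference_term E w -> property2 E -> property3 E.
Proof.
move=> Hw P2 [A [VA [be [dl [th [al [[cbe [cdl [cth cal]]]
  [[_ [_ [_ [_ [_ [_ [_ [ndlth _]]]]]]]] [dlth [meet [jdl [jth cen]]]]]]]]]]]].
have /centralizesP tc := (P2 A VA be dl cbe cdl).1 cen.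
set J := cjoin be dl in tc jdl.
have cJ : congruence J by apply: Cg_congruence.
have dlJ : Defs.subrel dl J by move=> x y xy; apply: sub_Cg; right.
have beJ : Defs.subrel be J by move=> x y xy; apply: sub_Cg; left.
have [rbe [sbe [tbe compbe]]] := cbe; have [rdl [sdl [tdl compdl]]] := cdl.
have [_ [sth [tth _]]] := cth; have [rJ [sJ [tJ _]]] := cJ.
pose R x y := exists b c, [/\ dl x b, be b c & dl c y].
have RJ x y : R x y -> J x y.
  by move=> [b [c [/dlJ H1 /beJ H2 /dlJ H3]]]; apply: tJ H1 (tJ _ _ _ H2 H3).
have compR : compatible R.
  move=> f x y /fun_choice [b /fun_choice [c H]].
  exists (@interp sig A f b), (@interp sig A f c).
  by split; [apply: compdl|apply: compbe|apply: compdl] => i; case: (H i).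
have rR x : R x x by exists x, x.
have cR : congruence R.
  split=> //; split; first by move=> x y [b [c [? ? ?]]]; exists c, b; split; auto.
  split=> // x y z xy yz.
  (* Modulo [dl], [w(x,y,y)] is [x] and [w(y,y,z)] is [z]; applying [w] to the [R]-pairs [(x,y)],
     [(y,y)], [(y,z)] relates these two values. *)
  have [_ H1] := weak_difference_term_mod Hw VA cdl cJ dlJ tc (sJ _ _ (RJ _ _ xy)).
  have [H2 _] := weak_difference_term_mod Hw VA cdl cJ dlJ tc (RJ _ _ yz).
  have [b [c [H3 H4 H5]]] : R (eval (env3 x y y) w) (eval (env3 y y z) w).
    apply: eval_compatible => // i.
    by case: i => [[|[|[|]]]] //= _; rewrite /env3 /=.
  by exists b, c; split=> //; [apply: tdl H3; apply: sdl|apply: tdl H2].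
(* A [th]-pair is linked by [dl], [be], [dl]. The middle link lies in both [be] and [th], hence in
   [dl], so [th] collapses to [dl]. *)
apply: ndlth => x y; split; first exact: dlth.
move=> xy; have /jdl Jxy : al x y by apply/jth; apply: sub_Cg; right.
have [|b [c [H1 H2 H3]]] := Jxy R cR.
  by move=> u v [] uv; [exists u, v|exists u, u].
have /meet[_ H4] : cmeet be th b c.
  by split=> //; apply: tth (sth _ _ (dlth _ _ H1)) (tth _ _ _ xy (sth _ _ (dlth _ _ H3))).
exact: tdl H1 (tdl _ _ _ H4 H3).
Qed.

End Variety.

(** * Abelian tolerances in Taylor varieties *)

Section AbelianTolerance.
Variables (sig : signature) (A : algebra sig) (T : A -> A -> Prop).
Variables (n : nat) (f : term sig 'I_n).
Hypotheses (tolT : tolerance T) (abT : abelian T).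
Hypothesis idem_f : forall a : A, eval (fun _ => a) f = a.
Hypothesis taylor_f : forall i : 'I_n, exists w z : 'I_n -> nat, w i <> z i /\
  forall env : nat -> A, eval (fun j => env (w j)) f = eval (fun j => env (z j)) f.

Notation th := (Cg T).

Let rT : forall a, T a a. Proof. by case: tolT. Qed.
Let sT : forall a b, T a b -> T b a. Proof. by case: tolT => _ []. Qed.
Let cT : compatible T. Proof. by case: tolT => _ []. Qed.
Let rth : forall a, th a a. Proof. by case: (Cg_congruence T). Qed.
Let sth : forall a b, th a b -> th b a. Proof. by case: (Cg_congruence T) => _ []. Qed.
Let tth : forall a b c, th a b -> th b c -> th a c.
Proof. by case: (Cg_congruence T) => _ [_ []]. Qed.
Let cth : compatible th. Proof. by case: (Cg_congruence T) => _ [_ []]. Qed.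

Lemma term_condition_Cg_tolerance : term_condition th T eq.
Proof. by apply: term_condition_Cg => //; apply/centralizesP. Qed.

(* A game with N rounds: an opponent picks the position at which p and q enter f,
   and the side arguments are then chosen so that p and q end up equal. *)
Fixpoint merges (N : nat) (p q : A) : Prop :=
  if N is N'.+1 then
    forall i, exists R : 'I_n -> A, (forall j, th p (R j)) /\
      merges N' (eval (upd R i p) f) (eval (upd R i q) f)
  else p = q.

(* The Taylor identity for position i, read in the variables a and b, compares
   g(b) with g(a) at position i; since g(a) = h(a), replacing g by h there
   changes only one side. *)
Lemma merges_step N g h a b :
  twin th g h -> T a b -> merges N (g a) (h a) -> merges N.+1 (g b) (h b).
Proof.
elim: N g h => [|N IH] g h tgh Tab Hm i; last first.
  have [R [thR HR]] := Hm i; exists R; split.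
    move=> j; apply: tth (thR j); apply: sth.
    by apply: twin_rel cth (twin_left rth tgh) _; apply: sub_Cg.
  apply: (IH (fun x => eval (upd R i (g x)) f) (fun x => eval (upd R i (h x)) f)) => //.
  exact: twin_eval_upd.
rewrite /= in Hm *.
have [w [z [wz Hf]]] := taylor_f i.
pose env m := if m == w i then b else a.
have Tenv m m' : T (env m) (env m') by rewrite /env; do 2?case: ifP => _; auto.
pose R j := g (env (w j)); pose Z j := g (env (z j)).
have Ri : R i = g b by rewrite /R /env eqxx.
have Zi : Z i = h a by rewrite /Z /env; case: eqP => // /esym.
have E0 : eval R f = eval Z f := Hf (fun m => g (env m)).
exists R; split=> [j|].
  apply: twin_rel cth (twin_left rth tgh) _; apply: sub_Cg.
  by rewrite (_ : b = env (w i)) // /env eqxx.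
rewrite (upd_same Ri) E0 -{1}(upd_same Zi); apply/esym.
(* The top row of the matrix gives [E0], the bottom row the goal. At position [i] it reads [g b],
   [g a] over [h b], [h a]; elsewhere the two rows agree. *)
have := term_condition_mat rT cT term_condition_Cg_tolerance _ E0; apply.
apply: mat_eval => j; rewrite /upd; case: eqP => [->|_].
  by rewrite Ri Zi -{1}Hm; apply: mat_twin => //; apply: sT.
apply: mat_col; apply: twin_rel cT (twin_left rT tgh) _; exact: Tenv.
Qed.

Lemma merges_sym N p q : th p q -> merges N p q -> merges N q p.
Proof.
elim: N p q => [p q _ ->|N IH p q pq H i] //.
have [R [thR HR]] := H i; exists R; split=> [j|].
  exact (tth (sth pq) (thR j)).
apply: IH => //; apply: (eval_compatible f cth) => j.
by rewrite /upd; case: ifP.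
Qed.

(** The [N] rounds uniting [q] and [r] are played first and act on [p] as a further polynomial; the
    [M] rounds for [p] and [q] then finish. *)
Lemma merges_trans N M p q r k :
  th p q -> (forall k, polynomial k -> merges M (k p) (k q)) -> polynomial k ->
  merges N (k q) (k r) -> merges (N + M) (k p) (k r).
Proof.
move=> pq HM; elim: N k => [|N IH] k pk /=; first by move=> <-; apply: HM.
move=> H i; have [R [thR HR]] := H i; exists R; split=> [j|].
  by apply: tth (thR j); apply: twin_rel cth (twin_polynomial rth pk) pq.
apply: (IH (fun x => eval (upd R i (k x)) f)) => //.
exact: twin_eval_upd.
Qed.

(** The results of a round stay [T]-related, so they coincide by induction, and the term condition
    then allows any [th]-related side arguments. By idempotence, [p] turns into [q] by exchanging
    the arguments of [f] one at a time. *)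
Lemma merges_tolerance N p q : T p q -> merges N p q -> p = q.
Proof.
elim: N p q => // N IH p q Tpq H.
have Hi i R' : (forall j, th p (R' j)) -> eval (upd R' i p) f = eval (upd R' i q) f.
  have [R [thR HR]] := H i => thR'.
  have HE : eval (upd R i p) f = eval (upd R i q) f.
    by apply: IH => //; apply: eval_compatible => // j; rewrite /upd; case: ifP.
  have := term_condition_mat rT cT term_condition_Cg_tolerance _ HE; apply.
  apply: mat_eval => j; rewrite /upd; case: ifP => _; first exact: mat_col.
  by apply: mat_row; apply: tth (thR' j); apply: sth.
rewrite -[p]idem_f -[q]idem_f.
apply: (stepwise_ind (x := fun _ => p) (y := fun _ => q)
  (P := fun z => eval (fun _ => p) f = eval z f)) => // z i zE zi ->.
rewrite -{1}(upd_same zi); apply: Hi => j.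
by case: (zE j) => -> //; apply: sub_Cg.
Qed.

(** Ranging over all polynomials gives compatibility; one bound [N] for all of them lets rounds be
    added in transitivity. *)
Definition mergeable p q :=
  th p q /\ exists N, forall k, polynomial k -> merges N (k p) (k q).

Lemma mergeable_congruence : congruence mergeable.
Proof.
have tM p q r : mergeable p q -> mergeable q r -> mergeable p r.
  move=> [pq [M HM]] [qr [N HN]]; split; first exact: tth pq qr.
  by exists (N + M) => k pk; apply: merges_trans (HN k pk).
have rM p : mergeable p p by split=> //; exists 0.
split=> //; split.
  move=> p q [pq [N HN]]; split; first exact: sth.
  exists N => k pk; apply: merges_sym (HN k pk).
  exact: twin_rel cth (twin_polynomial rth pk) pq.
split=> //; apply: compatible_translations => // o x i p q [pq [N HN]].
have px : polynomial (fun a => @interp sig A o (upd x i a)).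
  by apply: twin_interp_upd => //; apply: twin_id.
split; first exact: twin_rel cth (twin_polynomial rth px) pq.
by exists N => k pk; apply: (HN (fun a => k (@interp sig A o (upd x i a)))); apply: twin_comp.
Qed.

(** It suffices to move the variable along [T], which costs one extra round by [merges_step]. *)
Lemma mergeable_term_condition : term_condition th th mergeable.
Proof.
apply: term_condition_Cg => // g h a b tgh Tab [_ [N HN]]; split.
  exact: twin_rel cth tgh (rth b).
exists N.+1 => k pk.
apply: (merges_step (g := fun x => k (g x)) (h := fun x => k (h x)) _ Tab (HN k pk)).
by apply: twin_comp tgh; apply: twin_polynomial.
Qed.

Lemma mergeable_tolerance p q : T p q -> mergeable p q -> p = q.
Proof. by move=> Tpq [_ [N HN]]; apply: merges_tolerance (HN id (twin_id _)). Qed.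

Variables (E : term sig nat -> term sig nat -> Prop) (w : term sig 'I_3).
Hypotheses (VA : in_variety E A) (Hw : weak_difference_term E w).

Lemma weak_difference_term_tolerance a b : T a b ->
  eval (env3 a a b) w = b /\ eval (env3 b a a) w = b.
Proof.
move=> Tab.
have [H1 H2] := weak_difference_term_mod Hw VA mergeable_congruence
  (Cg_congruence T) (fun p q H => H.1) mergeable_term_condition (sub_Cg Tab).
split; apply: mergeable_tolerance => //;
  rewrite -{2}(weak_difference_term_idem b Hw VA); apply: eval_compatible => //;
  by case=> [[|[|[|]]]].
Qed.

Definition tol_sq (R : A -> A -> Prop) a b := exists c, R a c /\ R c b.

Lemma twin_tol_sq g h : twin (tol_sq T) g h ->
  exists m, twin T m g /\ twin T m h.
Proof.
elim=> [|c d [m [H1 H2]]|o g1 h1 _ IH].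
- by exists id; split; apply: twin_id.
- by exists (fun _ => m); split; apply: twin_const => //; apply: sT.
have [m H] := fun_choice IH.
exists (fun a => @interp sig A o (fun i => m i a)).
by split; apply: twin_interp => i; case: (H i).
Qed.

Lemma tol_sq_tolerance : tolerance (tol_sq T).
Proof.
split; first by move=> a; exists a.
split; first by move=> a b [c [H1 H2]]; exists c; split; apply: sT.
move=> o x y /fun_choice [c H]; exists (@interp sig A o c).
by split; apply: cT => i; case: (H i).
Qed.

(* With a T b and m the common T-twin of g and h, the value g(b) is w(g(a), m(a), m(b)):
   this holds with m in place of g, and the term condition carries it over. *)
Lemma tol_sq_abelian : abelian (tol_sq T).
Proof.
have tc := (centralizesP _ _ _).1 abT.
suff step g h a b : twin (tol_sq T) g h -> T a b -> g a = h a -> g b = h b.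
  apply/centralizesP => g h a b tgh [c [ac cb]] /(step _ _ _ _ tgh ac).
  exact: step tgh cb.
move=> /twin_tol_sq[m [tg th]] Tab Eab.
have key k : twin T m k -> k b = eval (env3 (k a) (m a) (m b)) w.
  move=> tk.
  have Tm : T (m a) (m b) by apply: twin_rel cT (twin_left rT tk) Tab.
  have Tk : T (m b) (k b) := twin_rel cT tk (rT b).
  rewrite -{1}(weak_difference_term_tolerance Tk).2.
  apply: (term_condition_mat (S := T) (a := eval (env3 (m b) (m b) (m b)) w)
    (b := eval (env3 (m a) (m a) (m b)) w) rT cT tc); last first.
    by rewrite (weak_difference_term_idem _ Hw VA) (weak_difference_term_tolerance Tm).1.
  apply: mat_eval; case=> [[|[|[|]]]] //= lt_i3; rewrite /env3 /=.
  - by apply: mat_twin => //; apply: sT.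
  - by apply: mat_col; apply: sT.
  - exact: mat_col.
by rewrite (key g) // (key h) // Eab.
Qed.

End AbelianTolerance.

(** * From a weak difference term to (1) *)

Section Main.
Variables (sig : signature) (E : term sig nat -> term sig nat -> Prop).

Lemma weak_difference_term_property1 w :
  has_taylor_term E -> weak_difference_term E w -> property1 E.
Proof.
move=> [n [f [idem_f taylor_f]]] Hw A VA T tolT abT.
(* The iterated squares of [T] increase and stay abelian; their union [U] is a congruence containing
   [T]. Arities being finite, any two twins over [U] are twins over a single level. *)
pose Tk k := iter k (@tol_sq sig A) T.
have HT k : tolerance (Tk k) /\ abelian (Tk k).
  elim: k => // k [tolk abk]; split; first exact: tol_sq_tolerance.
  apply: (tol_sq_abelian (f := f) tolk abk _ _ VA Hw) => [a|i]; first exact: idem_f.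
  have [u [v [uv H]]] := taylor_f i; exists u, v; split=> //; exact: H.
have rk k a : Tk k a a by case: (HT k) => [[]].
have mono k l a b : k <= l -> Tk k a b -> Tk l a b.
  move=> /subnKC <-; elim: (l - k) => [|m IH] H; first by rewrite addn0.
  by rewrite addnS; exists b; split; [exact: IH|exact: rk].
pose U a b := exists k, Tk k a b.
have cU : congruence U.
  have tU a b c : U a b -> U b c -> U a c.
    move=> [k Hk] [l Hl]; exists (maxn k l).+1, b.
    by split; [apply: mono Hk; apply: leq_maxl|apply: mono Hl; apply: leq_maxr].
  split; first by move=> a; exists 0.
  split; first by move=> a b [k Hk]; exists k; case: (HT k) => [[_ [sk _]] _]; apply: sk.
  split=> //; apply: compatible_translations => // [a|o x i a b [k Hk]]; first by exists 0.
  exists k; case: (HT k) => [[_ [_ ck]] _]; apply: ck => j.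
  by rewrite /upd; case: ifP.
have twU g h : twin U g h -> exists k, twin (Tk k) g h.
  elim=> [|c d [k Hk]|o g1 h1 _ IH].
  - by exists 0; apply: twin_id.
  - by exists k; apply: twin_const.
  have [k Hk] := fun_choice IH.
  exists (\max_i k i); apply: twin_interp => i.
  by apply: twin_mono (Hk i) => a b; apply: mono; apply: leq_bigmax.
have CU : Defs.subrel (Cg T) U by move=> a b; apply=> // x y xy; exists 0.
apply/centralizesP => g h a b /(twin_mono CU)/twU[k tgh] /CU[l ab].
have /centralizesP := (HT (maxn k l)).2; apply.
  by apply: twin_mono tgh => x y; apply: mono; apply: leq_maxl.
by apply: mono ab; apply: leq_maxr.
Qed.

End Main.

(** * The generic pair in an abelian congruence *)

Section Generic.
Variables (sig : signature) (E : term sig nat -> term sig nat -> Prop).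

Definition env2 (X : Type) (a b : X) (v : bool) : X := if v then b else a.

Definition term_algebra : algebra sig := @Algebra sig (term sig bool) (@App sig bool).

Lemma eval_term_algebra X (e : X -> term_algebra) t : eval e t = tsubst e t.
Proof. by elim: t => //= f args IH; congr App; apply: functional_extensionality. Qed.

Lemma hom_eval2 (B : algebra sig) (a b : B) :
  hom (A := term_algebra) (eval (env2 a b)).
Proof. by []. Qed.

(** The kernel onto the free object: the quotient of the term algebra by it is freely generated by
    two elements lying in an abelian congruence. *)
Definition abelian_eqv (s t : term_algebra) :=
  forall C : algebra sig, in_variety E C ->
  forall ps : C -> C -> Prop, congruence ps -> abelian ps ->
  forall a b, ps a b -> eval (env2 a b) s = eval (env2 a b) t.

Lemma abelian_eqv_congruence : congruence abelian_eqv.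
Proof.
split=> //; split; first by move=> s t H C VC ps c1 c2 a b ab; rewrite (H C VC ps).
split; first by move=> s t u H1 H2 C VC ps c1 c2 a b ab; rewrite (H1 _ _ ps) // (H2 _ _ ps).
move=> f x y H C VC ps c1 c2 a b ab /=; congr interp.
by apply: functional_extensionality => i; apply: (H i C VC ps).
Qed.

(* Modulo the identities, this is the congruence generated by the two variables. *)
Definition diagonal_eqv (s t : term_algebra) :=
  forall C : algebra sig, in_variety E C ->
  forall a : C, eval (fun _ => a) s = eval (fun _ => a) t.

Lemma diagonal_eqv_compatible : compatible diagonal_eqv.
Proof.
move=> f x y H C VC a /=; congr interp.
by apply: functional_extensionality => i; apply: (H i C VC).
Qed.

Lemma abelian_eqv_diagonal s t : abelian_eqv s t -> diagonal_eqv s t.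
Proof.
move=> H C VC a.
have := H C VC _ (congruence_eq C) (@abelian_zero _ C) a a erefl.
by rewrite (_ : env2 a a = (fun _ => a)) //; apply: functional_extensionality => -[].
Qed.

Lemma diagonal_eqv_rel s t (C : algebra sig) (ps : C -> C -> Prop) a b :
  diagonal_eqv s t -> in_variety E C -> congruence ps -> ps a b ->
  ps (eval (env2 a b) s) (eval (env2 a b) t).
Proof.
move=> st VC [rps [sps [tps cps]]] ab.
have H u : ps (eval (fun _ => a) u) (eval (env2 a b) u).
  by apply: (eval_compatible u cps) => -[].
by apply: tps (H t); rewrite -(st C VC a); apply: sps.
Qed.

(** Equality in the quotient is tested in each algebra [C] with an abelian congruence [ps].
    Evaluation there turns twins over [diagonal_eqv] into twins over [ps], so the term condition is
    inherited. *)
Lemma generic_abelian_pair : exists (B : algebra sig) (x y : B) (th : B -> B -> Prop),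
  [/\ in_variety E B, congruence th, abelian th, th x y &
  (forall b, exists t, b = eval (env2 x y) t) /\
  (forall s t, eval (env2 x y) s = eval (env2 x y) t -> abelian_eqv s t)].
Proof.
have [B [phi [hp surj phiE]]] := quotient_exists abelian_eqv_congruence.
exists B, (phi (Var sig false)), (phi (Var sig true)), (image_rel phi diagonal_eqv).
have evalE t : eval (env2 (phi (Var sig false)) (phi (Var sig true))) t = phi t.
  transitivity (phi (eval (A := term_algebra) (@Var sig bool) t)).
    by rewrite (hom_eval _ _ hp); apply: eval_ext => -[].
  congr phi; rewrite eval_term_algebra.
  by elim: t => //= f args IH; congr App; apply: functional_extensionality.
have cth : congruence (image_rel phi diagonal_eqv).
  split; first by move=> p; have [c <-] := surj p; exists c, c.
  split.
    move=> p q [c [d [H1 H2 H3]]]; exists d, c; split=> // C VC a.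
    by rewrite (H1 C VC).
  split; last by apply: image_compatible => //; apply: diagonal_eqv_compatible.
  move=> _ _ _ [c [d [H1 <- <-]]] [c' [d' [H2 /phiE/abelian_eqv_diagonal H3 <-]]].
  exists c, d'; split=> // C VC a.
  by rewrite (H1 C VC) -(H3 C VC) (H2 C VC).
split=> //.
- move=> s t Est env.
  have [e He] := fun_choice (fun v => surj (env v)).
  rewrite -!(functional_extensionality _ _ He : _ = env) -!(hom_eval _ _ hp).
  apply/phiE => C VC ps _ _ a b _; rewrite !eval_term_algebra !eval_tsubst.
  exact: VC.
- apply/centralizesP => g h _ _ /(twin_lift hp)[g0 [h0 [tgh H]]] [s [t [st <- <-]]].
  have [[-> ->] [-> ->]] := (H s, H t).
  move/phiE=> Es; apply/phiE => C VC ps cps abps a b ab.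
  have hev := hom_eval2 a b.
  have push u v : diagonal_eqv u v -> ps (eval (env2 a b) u) (eval (env2 a b) v).
    by move=> uv; apply: diagonal_eqv_rel.
  have [g1 [h1 [tgh1 H1]]] := twin_push hev push tgh.
  have [[Es1 Es2] [-> ->]] := (H1 s, H1 t).
  have /centralizesP tc := abps.
  apply: tc tgh1 (push _ _ st) _.
  by rewrite /zero_rel -Es1 -Es2; apply: (Es C VC ps).
- by exists (Var sig false), (Var sig true).
- split=> [b|s t]; last by rewrite !evalE => /phiE.
  by have [t <-] := surj b; exists t.
Qed.

End Generic.

(** * A congruence as a subalgebra of the square *)

Section Square.
Variables (sig : signature) (B : algebra sig) (th : B -> B -> Prop).
Hypothesis cth : compatible th.

Definition square_interp f (x : 'I_(arity f) -> {p : B * B | th p.1 p.2}) :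
    {p : B * B | th p.1 p.2} :=
  exist (fun p : B * B => th p.1 p.2)
    (@interp sig B f (fun i => (sval (x i)).1), @interp sig B f (fun i => (sval (x i)).2))
    (cth (fun i => svalP (x i))).

Definition square : algebra sig := Algebra square_interp.

Definition sq1 (p : square) : B := (sval p).1.
Definition sq2 (p : square) : B := (sval p).2.

Lemma hom_sq1 : hom sq1. Proof. by []. Qed.
Lemma hom_sq2 : hom sq2. Proof. by []. Qed.

Lemma sq_th (p : square) : th (sq1 p) (sq2 p).
Proof. exact: (svalP p). Qed.

Lemma sq_eq (p q : square) : sq1 p = sq1 q -> sq2 p = sq2 q -> p = q.
Proof.
case: p q => [[a b] ab] [[c d] cd]; rewrite /sq1 /sq2 /= => E1 E2; subst c d.
by congr exist; apply: proof_irrelevance.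
Qed.

Lemma square_in_variety E : in_variety E B -> in_variety E square.
Proof.
move=> VB s t Est env; apply: sq_eq.
  by rewrite !(hom_eval _ _ hom_sq1); apply: VB.
by rewrite !(hom_eval _ _ hom_sq2); apply: VB.
Qed.

(** The constants of a polynomial on [square] are [th]-related pairs, so its two coordinate maps are
    twins. *)
Lemma square_polynomial k : polynomial (A := square) k ->
  exists k1 k2, twin th k1 k2 /\
    forall p, sq1 (k p) = k1 (sq1 p) /\ sq2 (k p) = k2 (sq2 p).
Proof.
rewrite /polynomial => pk.
suff: forall k k', twin (A := square) eq k k' -> exists k1 k2, twin th k1 k2 /\
    forall p, sq1 (k p) = k1 (sq1 p) /\ sq2 (k p) = k2 (sq2 p) by apply; exact: pk.
move=> {pk} {}k k'; elim=> [|c d _|f g h _ IH].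
- by exists id, id; split=> //; apply: twin_id.
- exists (fun _ => sq1 c), (fun _ => sq2 c); split=> //; apply: twin_const.
  exact: sq_th.
have [k1 /fun_choice [k2 H]] := fun_choice IH.
exists (fun a => @interp sig B f (fun i => k1 i a)).
exists (fun a => @interp sig B f (fun i => k2 i a)).
split=> [|p]; first by apply: twin_interp => i; case: (H i).
rewrite hom_sq1 hom_sq2; split; congr interp; apply: functional_extensionality => i;
  by have [_ /(_ p)[E1 E2]] := H i; rewrite ?E1 ?E2.
Qed.

End Square.

(** * The obstruction to a weak difference term *)

Section Obstruction.
Variables (sig : signature) (E : term sig nat -> term sig nat -> Prop).
Variables (B : algebra sig) (x y : B) (th : B -> B -> Prop).
Hypotheses (VB : in_variety E B) (cth : congruence th) (abth : abelian th) (thxy : th x y).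
Hypothesis genB : forall b, exists t, b = eval (env2 x y) t.
Hypothesis freeB : forall s t, eval (env2 x y) s = eval (env2 x y) t -> abelian_eqv E s t.

Let rth : forall a, th a a. Proof. by case: cth. Qed.
Let sth : forall a b, th a b -> th b a. Proof. by case: cth => _ []. Qed.
Let tth : forall a b c, th a b -> th b c -> th a c. Proof. by case: cth => _ [_ []]. Qed.
Let compth : compatible th := match cth with conj _ (conj _ (conj _ c)) => c end.

Definition env_opt (X : Type) (v a b : X) (o : option bool) : X :=
  if o is Some s then env2 a b s else v.

(** The parameters of [k2] are written as terms in the generators. Moving the generators along [th]
    moves these parameters along [th], so they stay related to those of [k1]. *)
Lemma twin_generic k1 k2 : twin th k1 k2 ->
  exists K : term sig (option bool),
    (forall v, k2 v = eval (env_opt v x y) K) /\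
    forall x' y', th x x' -> th y y' ->
      twin th k1 (fun v => eval (env_opt v x' y') K).
Proof.
elim=> [|c d cd|f g h _ IH].
- by exists (Var sig None); split=> // *; apply: twin_id.
- have [t Et] := genB d.
  exists (tsubst (fun s => Var sig (Some s)) t); split.
    by move=> v; rewrite eval_tsubst.
  move=> x' y' xx' yy'.
  rewrite (_ : (fun v => eval _ _) = (fun _ => eval (env2 x' y') t)); last first.
    by apply: functional_extensionality => v; rewrite eval_tsubst.
  apply: twin_const; apply: tth cd _; rewrite Et.
  by apply: (eval_compatible t compth) => -[].
have [K H] := fun_choice IH.
exists (@App sig _ f K); split.
  move=> v /=; congr interp; apply: functional_extensionality => i.
  by case: (H i) => ->.
move=> x' y' xx' yy'.
apply: (twin_interp (h := fun i v => eval (env_opt v x' y') (K i))) => i.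
by case: (H i) => _; apply.
Qed.

(** The first equation is half of the weak difference condition at the generic pair; the other half
    is the case [z = y]. *)
Definition reachable (z : B) :=
  exists w : term sig 'I_3, eval (env3 y x x) w = y /\ eval (env3 x x y) w = z.

Lemma reachable_x : reachable x.
Proof. by exists (Var sig ord0). Qed.

Lemma reachable_weak_difference_term : reachable y -> has_weak_difference_term E.
Proof.
move=> [w [H1 H2]]; exists w => C VC ps cps abps a b ab.
have id3 (p q r : bool) : eval (env3 (env2 x y p) (env2 x y q) (env2 x y r)) w = y ->
    eval (env3 (env2 a b p) (env2 a b q) (env2 a b r)) w = b.
  move=> H.
  have Es (D : algebra sig) (u v : D) :
      eval (env2 u v) (tsubst (env3 (Var sig p) (Var sig q) (Var sig r)) w) =
      eval (env3 (env2 u v p) (env2 u v q) (env2 u v r)) w.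
    rewrite eval_tsubst; apply: eval_ext => i.
    by rewrite -(env3_map (fun s => env2 u v s)) -(env3_map (@Var sig bool)).
  have := freeB (s := tsubst (env3 (Var sig p) (Var sig q) (Var sig r)) w) (t := Var sig true).
  rewrite Es => /(_ H C VC ps cps abps a b ab).
  by rewrite Es.
by split; [apply: (id3 false false true)|apply: (id3 true false false)].
Qed.

(** Let [K(v,x,y)] be the term for [k2]. As [K(x,x,y) = y], freeness gives [K(u,u,v) = v] for all
    [th]-related [u] and [v]. If [w] reaches [z = k1 x], then [K] of the third variable, the second
    variable and [w] reaches [K(y,x,z)]. This is [k1 y], because the twins [k1] and [K(-,x,z)] agree
    at [x], hence at [y]. The converse takes the two variables in the opposite order. *)
Lemma reachable_twin k1 k2 : twin th k1 k2 -> k2 x = y ->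
  reachable (k1 x) <-> reachable (k1 y).
Proof.
move=> /twin_generic[K [EK tK]] k2x.
have K_id u v : th u v -> eval (env_opt u u v) K = v.
  move=> uv.
  have Es (D : algebra sig) (a b : D) :
      eval (env2 a b) (tsubst (fun o => Var sig (odflt false o)) K) = eval (env_opt a a b) K.
    by rewrite eval_tsubst; apply: eval_ext => -[].
  have := freeB (s := tsubst (fun o => Var sig (odflt false o)) K) (t := Var sig true).
  rewrite Es -EK k2x => /(_ erefl B VB th cth abth u v uv).
  by rewrite Es.
have tc := (centralizesP _ _ _).1 abth.
have Kxy : eval (env_opt x x y) K = y by rewrite -EK.
have sub3 (D : algebra sig) (e : 'I_3 -> D) (i j : 'I_3) w :
    eval e (tsubst (env_opt (Var sig i) (Var sig j) w) K) =
    eval (env_opt (e i) (e j) (eval e w)) K.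
  by rewrite eval_tsubst; apply: eval_ext => -[[]|].
pose i1 : 'I_3 := Ordinal (isT : 1 < 3); pose i2 : 'I_3 := Ordinal (isT : 2 < 3).
have thw z w : eval (env3 x x y) w = z -> eval (env3 y x x) w = y -> th y z.
  move=> <- {1}<-; apply: (eval_compatible w compth).
  by case=> [[|[|[|]]]] //= lt_i3; rewrite /env3 /=; auto.
split=> -[w [H1 H2]]; have yz := thw _ _ H2 H1.
- have xz := tth thxy yz.
  exists (tsubst (env_opt (Var sig i2) (Var sig i1) w) K).
  rewrite !sub3 H1 H2; split=> //; apply/esym.
  by apply: (tc _ _ _ _ (tK _ _ (rth x) yz) thxy); rewrite /zero_rel K_id.
- exists (tsubst (env_opt (Var sig i1) (Var sig i2) w) K).
  rewrite !sub3 H1 H2; split=> //; apply/esym.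
  by apply: (tc _ _ _ _ (tK _ _ thxy yz) (sth thxy)); rewrite /zero_rel K_id.
Qed.

Let A := square compth.

(** The pair [(x,y)] is marked, while [(y,y)] is marked only if [y] is reachable, and then a weak
    difference term exists. *)
Definition marked (p : A) := sq2 p = y -> reachable (sq1 p).

(* The kernel of the second projection, cut down to the largest congruence
   that saturates the marked elements. *)
Definition marking_rel (p q : A) :=
  sq2 p = sq2 q /\ forall k, polynomial k -> (marked (k p) <-> marked (k q)).

Lemma marking_rel_congruence : congruence marking_rel.
Proof.
have tR p q r : marking_rel p q -> marking_rel q r -> marking_rel p r.
  by move=> [E1 H1] [E2 H2]; split=> [|k pk]; rewrite ?E1 // (H1 k pk) (H2 k pk).
split=> //; split; first by move=> p q [E1 H]; split=> // k pk; rewrite (H k pk).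
split=> //; apply: compatible_translations => // f u i p q [E1 H]; split.
  rewrite !hom_sq2; congr interp.
  by rewrite !comp_upd E1.
move=> k pk; apply: (H (fun a => k (@interp sig A f (upd u i a)))).
by apply: twin_comp => //; apply: twin_interp_upd => //; apply: twin_id.
Qed.

Definition sq_mk a b (ab : th a b) : A := exist (fun p : B * B => th p.1 p.2) (a, b) ab.

(** Both elements have second coordinate [x] and polynomials act on the coordinates as twins, so
    [reachable_twin] applies. *)
Lemma marking_rel_generator (xx : th x x) (yx : th y x) :
  marking_rel (sq_mk xx) (sq_mk yx).
Proof.
split=> // k /square_polynomial[k1 [k2 [tk H]]].
rewrite /marked.
have [[-> ->] [-> ->]] := (H (sq_mk xx), H (sq_mk yx)).
rewrite /sq1 /sq2 /=.
by split=> Hk k2x; apply/(reachable_twin tk k2x); apply: Hk.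
Qed.

End Obstruction.

(** * From (2) or (3) to a weak difference term *)

Section Converse.
Variables (sig : signature) (E : term sig nat -> term sig nat -> Prop).

Lemma weak_difference_square : exists (A : algebra sig) (be eta dl : A -> A -> Prop)
    (o : bool -> bool -> A),
  [/\ in_variety E A, congruence be, congruence eta, congruence dl &
   [/\ forall p q, be p q -> eta p q -> p = q,
     Defs.subrel dl eta,
     term_condition be be eq,
     (forall u v v', be (o u v) (o u v')) /\ (forall u u' v, eta (o u v) (o u' v)) &
     dl (o false false) (o true false) /\
     (dl (o false true) (o true true) -> has_weak_difference_term E)]].
Proof.
have [B [x [y [th [VB cth abth thxy [genB freeB]]]]]] := generic_abelian_pair E.
have [rth [sth [tth compth]]] := cth.
pose A := square (match cth with conj _ (conj _ (conj _ c)) => c end).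
have hom1 : hom (@sq1 sig B th _ : A -> B) by [].
have thuv u v : th (env2 x y u) (env2 x y v).
  by case: u v => [] [] //=; apply: sth.
(* [o u v] is a pair of generators, with [false] standing for [x] and [true] for [y]. *)
pose o u v : A := sq_mk cth (thuv u v).
exists A, (fun p q => sq1 p = sq1 q), (fun p q => sq2 p = sq2 q).
exists (@marking_rel _ B x y th cth), o.
have tc := (centralizesP _ _ _).1 abth.
split.
- exact: square_in_variety.
- exact: congruence_preimage (@hom_sq1 _ _ _ _) (congruence_eq B).
- exact: congruence_preimage (@hom_sq2 _ _ _ _) (congruence_eq B).
- exact: marking_rel_congruence.
split.
- by move=> p q; apply: sq_eq.
- by move=> p q [].
(* First coordinates agree by compatibility. Elements with equal first coordinates have [th]-related
   second coordinates, where abelianness of [th] applies. *)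
- move=> g h p q tgh pq Ep.
  have push (c d : A) : sq1 c = sq1 d -> th (sq2 c) (sq2 d).
    by move=> cd; apply: tth (sq_th d); rewrite -cd; apply: sth; apply: sq_th.
  apply: sq_eq.
    by have [rE [_ [_ cE]]] := congruence_preimage hom1 (congruence_eq B);
       apply: (twin_rel cE tgh (rE q)).
  have [g1 [h1 [tgh1 H]]] := twin_push (@hom_sq2 _ _ _ _) push tgh.
  have [[E1 E2] [-> ->]] := (H p, H q).
  by apply: tc tgh1 (push _ _ pq) _; rewrite /zero_rel -E1 -E2 Ep.
- by split.
split; first exact: (marking_rel_generator (E := E)).
move=> [_ /(_ id (twin_id _)) [H _]].
apply: (reachable_weak_difference_term freeB).
by apply: H => // _; apply: reachable_x.
Qed.

Lemma property3_weak_difference_term : property3 E -> has_weak_difference_term E.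
Proof.
move=> P3; apply: NNPP => nw; apply: P3.
have [A [be [eta [dl [o [VA cbe ceta cdl [meet0 dleta tc [obe oeta] [dl0 dl1]]]]]]]] :=
  weak_difference_square.
have [rbe [sbe [tbe compbe]]] := cbe; have [rdl [sdl [tdl compdl]]] := cdl.
pose al := cjoin be dl; pose th := cmeet eta al.
have cal : congruence al by apply: Cg_congruence.
have [ral [sal [tal _]]] := cal.
have beal p q : be p q -> al p q by move=> H; apply: sub_Cg; left.
have dlal p q : dl p q -> al p q by move=> H; apply: sub_Cg; right.
have cth : congruence th by apply: congruence_cmeet.
have dlth p q : dl p q -> th p q by move=> H; split; [apply: dleta|apply: dlal].
(* The path is [(x,y) be (x,x) dl (y,x) be (y,y)]. *)
have tho : th (o false true) (o true true).
  split; first exact: oeta.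
  apply: (tal _ (o false false)); first exact (beal _ _ (obe _ _ _)).
  by apply: (tal _ (o true false)); [exact (dlal _ _ dl0)|exact (beal _ _ (obe _ _ _))].
have ndl : ~ dl (o false true) (o true true) by move=> /dl1.
have meet_th p q : be p q -> th p q -> p = q by move=> H [H' _]; apply: meet0.
have al_min (R : A -> A -> Prop) : congruence R -> Defs.subrel be R -> Defs.subrel dl R ->
    Defs.subrel al R.
  by move=> cR H1 H2 p q; apply=> // u v [/H1|/H2].
exists A; split=> //; exists be, dl, th, al; split=> //.
(* Distinctness of the five congruences comes down to [be] and [dl] being incomparable and [dl]
   differing from [th]. *)
have al_be_dl : Defs.subrel be dl -> False.
  by move=> H; apply/ndl/(al_min dl) => //; case: tho.
have al_dl_be : Defs.subrel dl be -> False.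
  move=> H; have /(al_min be cbe)-/(_ (fun _ _ => id) H) : al (o false true) (o true true).
    by case: tho.
  by move=> Hbe; apply: ndl; rewrite (meet_th _ _ Hbe tho).
split.
  split; first by move=> H; apply: al_be_dl => p q /H[].
  split; first by move=> H; apply: al_dl_be => p q /H[].
  split; first by move=> H; apply: al_dl_be => p q /dlth/H[].
  split; first by move=> H; apply: al_dl_be => p q /dlal/H[].
  split; first by move=> H; apply: al_be_dl => p q /H.
  split; first by move=> H; apply: al_dl_be => p q /dlth/H.
  split; first by move=> H; apply: al_dl_be => p q /dlal/H.
  split; first by move=> H; apply/ndl/H.
  split; first by move=> H; apply: al_be_dl => p q /beal/H.
  by move=> H; apply: al_be_dl => p q pq; have /H/(meet_th _ _ pq)-> := beal _ _ pq.
split=> //.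
split; first by move=> p q; split=> -[H1 H2]; split=> //;
  [rewrite (meet_th _ _ H1 H2)|apply: dlth].
split; first by move=> p q.
split.
  move=> p q; split.
    by apply=> // u v [/beal|[]].
  by apply: al_min => [|u v H|u v H]; [apply: Cg_congruence| |]; apply: sub_Cg;
    [left|right; apply: dlth].
apply/centralizesP => g h p q tgh pq [H1 H2].
rewrite (tc _ _ _ _ tgh pq (meet_th _ _ H1 (dlth _ _ H2))).
by split.
Qed.

(* In A/dl the elements o(0,0) and o(1,0) coincide, so the Taylor identity for
   position i shows that exchanging o(0,1) for o(1,1) there does not change the
   value when all other arguments are o(0,0), hence for any other arguments. *)
Lemma property2_weak_difference_term :
  has_taylor_term E -> property2 E -> has_weak_difference_term E.
Proof.
move=> [n [f [idem_f taylor_f]]] P2.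
have [A [be [eta [dl [o [VA cbe ceta cdl [meet0 dleta tc [obe oeta] [dl0 dl1]]]]]]]] :=
  weak_difference_square.
have [rbe [sbe [tbe compbe]]] := cbe; have [rdl [sdl [tdl compdl]]] := cdl.
have [_ [_ [_ competa]]] := ceta.
pose al := cjoin be dl.
have [ral [sal [tal compal]]] : congruence al by apply: Cg_congruence.
have beal p q : be p q -> al p q by move=> H; apply: sub_Cg; left.
have dlal p q : dl p q -> al p q by move=> H; apply: sub_Cg; right.
(* Since [be] and [dl] meet in equality, the term condition for [be] makes the lower interval
   abelian, and (2) transfers this to the interval from [dl] to [al]. *)
have tcal : term_condition al al dl.
  apply/centralizesP/(P2 A VA be dl cbe cdl).1/centralizesP => g h p q tgh pq [H1 H2].
  by rewrite (tc _ _ _ _ tgh pq (meet0 _ _ H1 (dleta _ _ H2))).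
have alo u v : al (o u v) (o false false).
  have H : al (o u false) (o false false).
    by case: u; [exact (sal _ _ (dlal _ _ dl0))|exact (ral _)].
  exact (tal _ _ _ (beal _ _ (obe _ _ _)) H).
apply: dl1; rewrite -(idem_f A VA (o false true)) -(idem_f A VA (o true true)).
apply: (stepwise_ind (x := fun _ => o false true) (y := fun _ => o true true)
  (P := fun z => dl (eval (fun _ => o false true) f) (eval z f))) => // z i zE zi dlz.
apply: (tdl _ _ _ dlz); rewrite -{1}(upd_same zi).
have [w [w' [ww' Hf]]] := taylor_f i.
(* The first coordinates follow the Taylor identity, with [x] at position [i] on the [w] side and
   [y] on the [w'] side. The second coordinate is [y] at position [i] only, the same on both sides,
   so the two values in [E1] agree in both coordinates. *)
pose s m := m != w i.
have si : s (w i) = false by rewrite /s eqxx.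
have s'i : s (w' i) by apply/eqP => /esym.
pose u j := j == i.
have E1 : eval (fun j => o (s (w j)) (u j)) f = eval (fun j => o (s (w' j)) (u j)) f.
  apply: meet0; last by apply: (eval_compatible f competa) => j; apply: oeta.
  have E0 := Hf A VA (fun m => o (s m) false).
  have H v : be (eval (fun j => o (s (v j)) (u j)) f) (eval (fun j => o (s (v j)) false) f).
    by apply: (eval_compatible f compbe) => j; apply: obe.
  by apply: tbe (H w) _; rewrite E0; apply: sbe.
have dlu v : dl (eval (fun j => o (s (v j)) (u j)) f)
    (eval (upd (fun _ => o false false) i (o (s (v i)) true)) f).
  apply: (eval_compatible f compdl) => j; rewrite /u /upd; case: eqP => [->|_] //.
  by case: (s (v j)) => //; apply: sdl.
have H0 : dl (eval (upd (fun _ => o false false) i (o false true)) f)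
    (eval (upd (fun _ => o false false) i (o true true)) f).
  have := dlu w; have := dlu w'; rewrite si s'i E1 => H1 H2.
  exact: tdl (sdl _ _ H2) H1.
apply: (term_condition_mat (S := al) (T := al) ral compal tcal _ H0).
apply: mat_eval => j; rewrite /upd; case: eqP => _.
  by apply: mat_col; apply: (tal _ (o false false)) => //; apply: sal.
by apply: mat_row; apply: sal; case: (zE j) => ->.
Qed.

End Converse.

Theorem theorem5p1 (sig : signature) (E : term sig nat -> term sig nat -> Prop) :
  has_taylor_term E ->
  (property1 E <-> has_weak_difference_term E) /\
  (property2 E <-> has_weak_difference_term E) /\
  (property3 E <-> has_weak_difference_term E).
Proof.
move=> taylor.
have P2w := property2_weak_difference_term taylor.
have wP1 : has_weak_difference_term E -> property1 E.
  by move=> [w Hw]; apply: weak_difference_term_property1 Hw.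
have wP2 : has_weak_difference_term E -> property2 E.
  by move=> /wP1/property1_property2.
split; [|split]; split=> //.
- by move=> /property1_property2.
- exact: property3_weak_difference_term.
- by move=> Hw; have [w ww] := Hw; apply: property3_of_property2 ww (wP2 Hw).
Qed.
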